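(* Let $n\ge m\ge k\ge 2$ be integers. If $A$ is an $m\times n$ (entrywise) nonnegative matrix with $\|A\|_{\max}\le 1$, then $$\|A\|_{[k]}\le \frac{\sqrt{kmn}}{2}+\frac{\sqrt{mn}}{2}.$$ Equality holds if and only if the matrix $2A-J_{m,n}$ is a regular $(-1,1)$-matrix, with row sums equal to $n/\sqrt k$, and with exactly $k$ nonzero singular values, which are all equal to $\sqrt{mn/k}$.
   Context: For an $m\times n$ matrix $A=[a_{i,j}]$ with $n\ge m$, $\sigma_1(A)\ge\sigma_2(A)\ge\cdots\ge\sigma_m(A)$ denote its singular values, the Ky Fan $k$-norm is $\|A\|_{[k]}:=\sigma_1(A)+\cdots+\sigma_k(A)$ for $1\le k\le m$, and $\|A\|_{\max}:=\max_{i,j}|a_{i,j}|$. $J_{m,n}$ is the $m\times n$ all-ones matrix. A $(-1,1)$-matrix is a matrix all of whose entries are $-1$ or $1$. A matrix is called regular if all its row sums are equal and all its column sums are equal. *)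

(* Defs.v *)
From HB Require Import structures.
From mathcomp Require Import all_boot all_order all_algebra.
From mathcomp Require Import reals matrix_normedtype polyrcf.

Set Implicit Arguments.
Unset Strict Implicit.
Unset Printing Implicit Defensive.

Import Order.TTheory GRing.Theory Num.Theory.
Local Open Scope ring_scope.

(* [rootsR p] lists each real root of [p] only once, hence the multiplicities.
   When [M] is symmetric, all its eigenvalues are real, so this list has
   length [m]. *)
Definition real_eigenvalues (R : rcfType) (m : nat) (M : 'M[R]_m) : seq R :=
  flatten [seq nseq (mup x (char_poly M)) x | x <- rootsR (char_poly M)].

(* [A *m A^T] is [m] by [m], so an [m] by [n] matrix gets exactly [m] singular
   values; for [m <= n] this is the usual number. *)
Definition singular_values (R : rcfType) (m n : nat) (A : 'M[R]_(m, n)) : seq R :=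
  sort >=%R [seq Num.sqrt x | x <- real_eigenvalues (A *m A^T)].

(* Indices start at 0: [singular_value A i] is sigma_(i+1)(A). *)
Definition singular_value (R : rcfType) (m n : nat) (A : 'M[R]_(m, n))
    (i : nat) : R :=
  nth 0 (singular_values A) i.

Definition ky_fan_norm (R : rcfType) (m n : nat) (k : nat) (A : 'M[R]_(m, n)) : R :=
  \sum_(i < k) singular_value A i.

Definition pm1_matrix (R : rcfType) (m n : nat) (A : 'M[R]_(m, n)) : Prop :=
  forall i j, A i j = -1 \/ A i j = 1.

Definition row_sum (R : rcfType) (m n : nat) (A : 'M[R]_(m, n)) (i : 'I_m) : R :=
  \sum_(j < n) A i j.

Definition col_sum (R : rcfType) (m n : nat) (A : 'M[R]_(m, n)) (j : 'I_n) : R :=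
  \sum_(i < m) A i j.

Definition regular_matrix (R : rcfType) (m n : nat) (A : 'M[R]_(m, n)) : Prop :=
  (forall i i', row_sum A i = row_sum A i') /\
  (forall j j', col_sum A j = col_sum A j').

(* Main.v *)
Require Import Defs.
From HB Require Import structures.
From mathcomp Require Import all_boot all_order all_algebra perm.
From mathcomp Require Import ring lra.
From mathcomp Require Import reals matrix_normedtype polyrcf complex.

Import Order.TTheory GRing.Theory Num.Theory.
Local Open Scope ring_scope.

(** Write [J] for the all-ones matrix, [B = 2 *: A - J], so that the entries of
    [B] lie between -1 and 1 and [A] is half of [J + B]. There is a partial
    isometry [X] of squared Frobenius norm at most [k] whose inner product with
    [A] is the Ky Fan norm of [A] (lemma [ky_fan_attained]). Hence twice that
    norm is the inner product of [X] with [J] plus that with [B]. The first is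
    at most [sqrt (m n)], because [X] is a contraction and [J] is the outer
    product of two vectors of lengths [sqrt m] and [sqrt n]; the second is at
    most [sqrt k * sqrt (m n)], by Cauchy-Schwarz for the Frobenius norm. This
    is the inequality.

    If equality holds, both Cauchy-Schwarz inequalities are equalities (lemma
    [tr_gram_le]). The second one gives [B = c *: X] with [c = sqrt (m n / k)]
    and shows that [B] has the largest possible Frobenius norm, so its entries
    are all -1 or 1. As [X] is a partial isometry of rank [k], the singular
    values of [B] are 0 and [c], the latter [k] times. The first one says that
    [X] and its transpose exchange the normalized all-ones vectors, which gives
    the row and column sums of [B].

    Conversely, the regularity of [B] and its two-valued spectrum provide an
    explicit positive semidefinite square root of [A *m A^T], of rank at most
    [k]. The Ky Fan norm is its trace (lemmas [ky_fan_norm_sqrt] and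
    [ky_fan_norm_flat_regular]).

    Singular values are defined from the roots of a characteristic polynomial.
    The real spectral theorem ([symmetric_spectral]) connects them to
    orthonormal eigenvectors. *)

(** * The Frobenius inner product *)

(** Throughout, [\tr (A *m B^T)] serves as the Frobenius inner product of two
    real matrices, and [\tr (A *m A^T)] as the squared Frobenius norm. *)
Lemma tr_gram {R : pzSemiRingType} {m n : nat} (A B : 'M[R]_(m, n)) :
  \tr (A *m B^T) = \sum_i \sum_j A i j * B i j.
Proof. by apply: eq_bigr => i _; rewrite mxE; apply: eq_bigr => j _; rewrite mxE. Qed.

Lemma tr_gram_ge0 {R : realDomainType} {m n : nat} (A : 'M[R]_(m, n)) :
  0 <= \tr (A *m A^T).
Proof.
by rewrite tr_gram; do 2!apply: sumr_ge0 => ? _; rewrite -expr2 sqr_ge0.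
Qed.

Lemma tr_gram_eq0 {R : realDomainType} {m n : nat} (A : 'M[R]_(m, n)) :
  \tr (A *m A^T) = 0 -> A = 0.
Proof.
rewrite tr_gram => /eqP A0; apply/matrixP=> i j; rewrite mxE.
move: A0; rewrite psumr_eq0 => [/allP/(_ i (mem_index_enum _))/implyP/(_ isT)|];
  last by move=> ? _; apply: sumr_ge0 => ? _; rewrite -expr2 sqr_ge0.
rewrite psumr_eq0 => [/allP/(_ j (mem_index_enum _))/implyP/(_ isT)|];
  last by move=> ? _; rewrite -expr2 sqr_ge0.
by rewrite mulf_eq0 orbb => /eqP.
Qed.

(** Cauchy-Schwarz for matrices of norms at most [a] and [b], with its equality
    case. Both come from expanding the squared norm of [b *: X - a *: Y], which
    is at most [2 * (a * b) * (a * b - \tr (X *m Y^T))]. *)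
Lemma tr_gram_le {R : realFieldType} {m n : nat} (a b : R) (X Y : 'M[R]_(m, n)) :
  0 < a -> 0 < b -> \tr (X *m X^T) <= a ^+ 2 -> \tr (Y *m Y^T) <= b ^+ 2 ->
  \tr (X *m Y^T) <= a * b /\
  (\tr (X *m Y^T) = a * b ->
    [/\ \tr (X *m X^T) = a ^+ 2, \tr (Y *m Y^T) = b ^+ 2 & b *: X = a *: Y]).
Proof.
move=> a0 b0 lX lY; have ab0 : 0 < a * b by rewrite mulr_gt0.
have eYX : \tr (Y *m X^T) = \tr (X *m Y^T).
  by rewrite -mxtrace_tr trmx_mul trmxK.
have eD : \tr ((b *: X - a *: Y) *m (b *: X - a *: Y)^T)
    = b ^+ 2 * \tr (X *m X^T) + a ^+ 2 * \tr (Y *m Y^T) - 2 * (a * b) * \tr (X *m Y^T).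
  rewrite [(_ - _)^T]linearB /= ![(_ *: _)^T]linearZ /= mulmxBl !mulmxBr -!scalemxAl -!scalemxAr.
  by rewrite !linearB !linearZ /= eYX; ring.
have D0 := tr_gram_ge0 (b *: X - a *: Y).
have lbX : b ^+ 2 * \tr (X *m X^T) <= b ^+ 2 * a ^+ 2 by rewrite ler_pM2l ?exprn_gt0.
have laY : a ^+ 2 * \tr (Y *m Y^T) <= a ^+ 2 * b ^+ 2 by rewrite ler_pM2l ?exprn_gt0.
split=> [|eXY]; first by rewrite -(ler_pM2l ab0); rewrite eD in D0; nra.
rewrite eD eXY in D0.
have bX : b ^+ 2 * \tr (X *m X^T) = b ^+ 2 * a ^+ 2 by nra.
have aY : a ^+ 2 * \tr (Y *m Y^T) = a ^+ 2 * b ^+ 2 by nra.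
split.
- by apply: (mulfI _ bX); rewrite expf_neq0 ?gt_eqF.
- by apply: (mulfI _ aY); rewrite expf_neq0 ?gt_eqF.
- by apply/eqP; rewrite -subr_eq0; apply/eqP/tr_gram_eq0; rewrite eD bX aY eXY; ring.
Qed.

(** The identity [X *m X^T *m X = X] says that [X] is a partial isometry:
    [X *m X^T] is then an orthogonal projection, so by Pythagoras the squared
    length lost by [y] under [X] is that of its component off the projection. *)
Lemma partial_isometry_contraction {R : realDomainType} {m n : nat}
    (X : 'M[R]_(m, n)) (y : 'rV[R]_m) : X *m X^T *m X = X ->
  \tr ((y *m X) *m (y *m X)^T) <= \tr (y *m y^T) /\
  (\tr ((y *m X) *m (y *m X)^T) = \tr (y *m y^T) -> y *m (X *m X^T) = y).
Proof.
move=> XX; set P := X *m X^T.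
have PP : P *m P = P by rewrite /P mulmxA XX.
have trP : P^T = P by rewrite /P trmx_mul trmxK.
have eyX : (y *m X) *m (y *m X)^T = y *m P *m y^T by rewrite trmx_mul !mulmxA.
clearbody P; have eD : \tr ((y - y *m P) *m (y - y *m P)^T)
    = \tr (y *m y^T) - \tr ((y *m X) *m (y *m X)^T).
  rewrite eyX [(_ - _)^T]linearB /= trmx_mul trP mulmxBl !mulmxBr !mulmxA.
  by rewrite -(mulmxA y P P) PP subrr subr0 linearB.
split=> [|e]; first by rewrite -subr_ge0 -eD tr_gram_ge0.
apply/esym/eqP; rewrite -subr_eq0; apply/eqP/tr_gram_eq0.
by rewrite eD e subrr.
Qed.

(** Each of the [m * n] terms [1 - B i j ^+ 2] is nonnegative, so their sum
    vanishes only if they all do. *)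
Lemma tr_gram_bounded {R : realFieldType} {m n : nat} (B : 'M[R]_(m, n)) :
  (forall i j, `|B i j| <= 1) ->
  \tr (B *m B^T) <= (m * n)%:R /\
  (\tr (B *m B^T) = (m * n)%:R -> forall i j, B i j = -1 \/ B i j = 1).
Proof.
move=> B1.
have B0 i j : 0 <= 1 - B i j ^+ 2 by rewrite subr_ge0 -real_normK ?num_real // expr_le1.
have eB : (m * n)%:R - \tr (B *m B^T) = \sum_i \sum_j (1 - B i j ^+ 2).
  under [RHS]eq_bigr => i _ do rewrite sumrB sumr_const card_ord.
  rewrite sumrB sumr_const card_ord -mulrnA [in LHS]mulnC tr_gram.
  by congr (_ - _); apply: eq_bigr => i _; apply: eq_bigr => j _; rewrite expr2.
split=> [|eBB i j].
  by rewrite -subr_ge0 eB; do 2!apply: sumr_ge0 => ? _.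
move/eqP: eB; rewrite eBB subrr eq_sym psumr_eq0 => [|l _]; last exact: sumr_ge0.
move=> /allP/(_ i (mem_index_enum _))/implyP/(_ isT).
rewrite psumr_eq0 // => /allP/(_ j (mem_index_enum _))/implyP/(_ isT).
by rewrite subr_eq0 eq_sym sqrf_eq1 => /orP[]/eqP; [right|left].
Qed.

(** * The spectral theorem for real symmetric matrices *)

(** The complexified matrix is Hermitian, so the complex spectral theorem gives
    it a real eigenvalue, which is a root of the real characteristic polynomial. *)
Lemma symmetric_eigenvalue {R : rcfType} {n : nat} (M : 'M[R]_n.+1) :
  M^T = M -> exists a, eigenvalue M a.
Proof.
move=> symM; pose Mc := map_mx (real_complex R) M.
have hermMc : Mc \is hermsymmx.
  apply: realsym_hermsym; last by apply/mxOverP=> i j; rewrite mxE complex_real.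
  by apply/is_hermitianmxP; rewrite expr0 scale1r map_mx_id // map_trmx symM.
have /orthomx_spectralP eMc := hermitian_normalmx hermMc.
have /mxOverP/(_ 0 0)/complex_realP[a ea] := hermitian_spectral_diag_real hermMc.
exists a; rewrite eigenvalue_root_char -(fmorph_root (real_complex R)).
rewrite map_char_poly -eigenvalue_root_char -/Mc -[_ a]ea.
have uP := spectral_unit Mc.
apply/eigenvalueP; exists (row 0 (spectralmx Mc)).
  rewrite {2}eMc -row_mul !mulmxA mulmxV // mul1mx row_mul row_diag_mx.
  by rewrite -scalemxAl -rowE.
rewrite rowE mulmx_free_eq0 ?row_free_unit //.
by apply/eqP=> /matrixP/(_ 0 0)/eqP; rewrite !mxE eqxx oner_eq0.
Qed.

(** The Householder reflection exchanging [v] and the first basis vector is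
    orthogonal; its first row is [v]. The reflection degenerates to the
    identity when [v] is already the basis vector. *)
Lemma unit_row_completion {R : realFieldType} {n : nat} (v : 'rV[R]_n.+1) :
  v *m v^T = 1%:M -> exists H : 'M[R]_n.+1, H *m H^T = 1%:M /\ row 0 H = v.
Proof.
move=> v1; pose e : 'rV[R]_n.+1 := delta_mx 0 0; pose w := v - e.
have ee : e *m e^T = 1%:M.
  by rewrite trmx_delta mul_delta_mx; apply/matrixP=> i j; rewrite !ord1 !mxE.
pose t := (e *m v^T) 0 0.
have ev : e *m v^T = t%:M by rewrite [LHS]mx11_scalar.
have ve : v *m e^T = t%:M by rewrite -[LHS]trmxK trmx_mul trmxK ev tr_scalar_mx.
have ww : w *m w^T = (2 * (1 - t))%:M.
  rewrite /w linearB /= mulmxBl !mulmxBr v1 ee ev ve -!raddfB /=.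
  by congr (_%:M); ring.
have [t1|t1] := eqVneq t 1.
  have w0 : w = 0 by apply: tr_gram_eq0; rewrite ww t1 subrr mulr0 raddf0 mxtrace0.
  by exists 1%:M; rewrite trmx1 mulmx1 row1; move/eqP: w0; rewrite subr_eq0 => /eqP.
have ew : e *m w^T = (t - 1)%:M by rewrite /w linearB /= mulmxBr ev ee -raddfB.
have -> : v = w + delta_mx 0 0 by rewrite subrK.
have t1' : 1 - t != 0 by rewrite subr_eq0 eq_sym.
have e0 : e = delta_mx 0 0 by [].
rewrite -e0; clearbody t w e.
exists (1%:M - (1 - t)^-1 *: (w^T *m w)); split; last first.
  rewrite rowE -e0 mulmxBr mulmx1 -scalemxAr mulmxA ew mul_scalar_mx scalerA.
  by rewrite -(opprB 1 t) mulrN mulVf // scaleN1r opprK addrC.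
have -> : (1%:M - (1 - t)^-1 *: (w^T *m w))^T = 1%:M - (1 - t)^-1 *: (w^T *m w).
  by rewrite linearB /= linearZ /= trmx_mul trmxK trmx1.
rewrite mulmxBl !mulmxBr !mul1mx mulmx1 -scalemxAl -scalemxAr.
rewrite mulmxA -(mulmxA w^T) ww mul_mx_scalar -scalemxAl !scalerA.
rewrite -addrA -[RHS]addr0; congr (_ + _).
rewrite -scalerBl -opprD -scalerDl -[RHS]oppr0 -[in RHS](scale0r (w^T *m w)).
congr (- (_ *: _)).
by field.
Qed.

(** Real spectral theorem, by deflation: in an orthonormal basis that starts
    with a unit eigenvector, symmetry makes the matrix block diagonal. *)
Theorem symmetric_spectral {R : rcfType} {n : nat} (M : 'M[R]_n) : M^T = M ->
  exists (U : 'M[R]_n) (d : 'rV[R]_n),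
    U *m U^T = 1%:M /\ M = U^T *m diag_mx d *m U.
Proof.
elim: n M => [|n IHn] M symM.
  by exists 1%:M, 0; split; apply/matrixP=> - [].
have [a /eigenvalueP[v0 v0M v0n]] := symmetric_eigenvalue M symM.
have v0gt0 : 0 < \tr (v0 *m v0^T).
  by rewrite lt0r tr_gram_ge0 andbT; apply: contra_neq v0n => /tr_gram_eq0.
pose s := Num.sqrt (\tr (v0 *m v0^T)); pose v := s^-1 *: v0.
have s0 : s != 0 by rewrite sqrtr_eq0 -ltNge.
have v1 : v *m v^T = 1%:M.
  rewrite /v linearZ /= -scalemxAl -scalemxAr scalerA [_ *m _]mx11_scalar.
  rewrite -[X in X%:M]addr0 -trace_mx11 -(@sqr_sqrtr _ (\tr _)) ?(ltW v0gt0) // -/s.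
  by rewrite scale_scalar_mx addr0 -expr2 -exprMn mulVf // expr1n.
have vM : v *m M = a *: v by rewrite -scalemxAl v0M !scalerA mulrC.
have [H [HH rH]] := unit_row_completion v v1.
have HtH : H^T *m H = 1%:M by apply: mulmx1C.
pose N : 'M[R]_(1 + n) := H *m M *m H^T.
have symN : N^T = N by rewrite /N !trmx_mul trmxK symM mulmxA.
have rN : row 0 N = a *: delta_mx 0 0.
  by rewrite /N !row_mul rH vM -scalemxAl -rH -row_mul HH row1.
have eM : M = H^T *m N *m H by rewrite /N !mulmxA HtH mul1mx -mulmxA HtH mulmx1.
clearbody N.
have [U' [d' [U'1 eN']]] : exists (U : 'M[R]_n) (d : 'rV[R]_n),
    U *m U^T = 1%:M /\ drsubmx N = U^T *m diag_mx d *m U.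
  by apply: IHn; rewrite trmx_drsub symN.
have eN : N = block_mx a%:M 0 0 (U'^T *m diag_mx d' *m U').
  have N0 j : N 0 j = a * (0 == j)%:R.
    by move/rowP/(_ j): rN; rewrite !mxE /= eq_sym.
  have N0' j : N j 0 = a * (0 == j)%:R by rewrite -symN mxE N0.
  have l0 : lshift n (0 : 'I_1) = 0 by apply: val_inj.
  rewrite -eN' -[LHS]submxK; congr block_mx; apply/matrixP=> i j.
  - by rewrite !ord1 !mxE l0 N0 mulr1.
  - by rewrite !ord1 !mxE l0 N0 mulr0.
  - by rewrite !ord1 !mxE l0 N0' mulr0.
pose V : 'M[R]_(1 + n) := block_mx 1%:M 0 0 U'.
pose d : 'rV[R]_(1 + n) := row_mx a%:M d'.
have VV : V *m V^T = 1%:M.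
  rewrite /V tr_block_mx mulmx_block.
  rewrite !(trmx0, mul0mx, mulmx0, add0r, addr0) trmx1 mulmx1 U'1.
  by rewrite -scalar_mx_block.
have VN : N = V^T *m diag_mx d *m V.
  rewrite eN /V tr_block_mx diag_mx_row !mulmx_block.
  rewrite !(trmx0, mul0mx, mulmx0, add0r, addr0) trmx1 !mul1mx !mulmx1.
  by congr block_mx; apply/matrixP=> i j; rewrite !ord1 !mxE eqxx.
exists ((V : 'M_n.+1) *m H), d; split; last by rewrite eM VN trmx_mul !mulmxA.
by rewrite trmx_mul mulmxA -(mulmxA _ H) HH mulmx1.
Qed.

(** * Eigenvalues and singular values of orthogonally diagonalized matrices *)

(** Similarity invariance, carried out over polynomial matrices because the
    determinant being computed lives there. *)
Lemma char_poly_orthogonal_conj {R : comNzRingType} {n : nat} (U D : 'M[R]_n) :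
  U *m U^T = 1%:M -> char_poly (U^T *m D *m U) = char_poly D.
Proof.
move=> UU; have UtU := mulmx1C UU; pose UP := map_mx (@polyC R) U.
have UtUP : UP^T *m UP = 1%:M by rewrite map_trmx -map_mxM UtU map_mx1.
rewrite /char_poly; have -> : char_poly_mx (U^T *m D *m U)
    = UP^T *m char_poly_mx D *m UP.
  rewrite /char_poly_mx mulmxBr mulmxBl !map_mxM /= -map_trmx; congr (_ - _).
  by rewrite mul_mx_scalar -scalemxAl UtUP scalemx1.
by rewrite !det_mulmx mulrAC -det_mulmx UtUP det1 mul1r.
Qed.

Lemma mup_prod_XsubC {F : fieldType} (x : F) (s : seq F) :
  mup x (\prod_(a <- s) ('X - a%:P)) = count_mem x s.
Proof.
elim: s => [|a s IHs]; first by rewrite big_nil mupNroot // root1.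
rewrite big_cons mupM ?polyXsubC_eq0 ?monic_neq0 ?monic_prod_XsubC //=.
by rewrite IHs -['X - a%:P]expr1 mup_XsubCX; case: eqP.
Qed.

(** The characteristic polynomial splits into the factors ['X - d_i], so the
    multiplicity of a root is the number of times it occurs in [d]. *)
Lemma real_eigenvalues_diag {R : rcfType} {n : nat} (U : 'M[R]_n) (d : 'rV[R]_n) :
  U *m U^T = 1%:M ->
  perm_eq (real_eigenvalues (U^T *m diag_mx d *m U)) [seq d 0 i | i <- enum 'I_n].
Proof.
move=> UU; rewrite /real_eigenvalues char_poly_orthogonal_conj //.
set s := [seq _ | _ <- enum _].
have -> : char_poly (diag_mx d) = \prod_(a <- s) ('X - a%:P).
  rewrite char_poly_trig ?diag_mx_is_trig // big_map big_enum /=.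
  by apply: eq_bigr => i _; rewrite !mxE eqxx mulr1n.
set p := \prod_(a <- s) _.
have p0 : p != 0 by rewrite monic_neq0 ?monic_prod_XsubC.
have ur : uniq (rootsR p) by exact/lt_sorted_uniq/sorted_roots.
apply/allP=> x _ /=; rewrite count_flatten -map_comp sumnE big_map.
rewrite (eq_bigr (fun r => (r == x) * count_mem x s)%N) => [|r _]; last first.
  by rewrite /= count_nseq mup_prod_XsubC /=; case: eqP => // ->.
rewrite -big_distrl /=.
have -> : (\sum_(r <- rootsR p) (r == x) = count_mem x (rootsR p))%N.
  by rewrite -sumn_count sumnE big_map.
rewrite count_uniq_mem // -(roots_on_rootsR p0) inE /= root_prod_XsubC.
by case: (boolP (x \in s)) => [_|/count_memPn ->]; rewrite ?mul1n.
Qed.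

(** Uniqueness of singular values: any orthogonal diagonalization of
    [A *m A^T] with nonnegative square roots [s] finds them. *)
Lemma singular_values_sqrt {R : rcfType} {m n : nat} (A : 'M[R]_(m, n))
    (U : 'M[R]_m) (s : 'I_m -> R) :
    U *m U^T = 1%:M -> (forall i, 0 <= s i) ->
    A *m A^T = U^T *m diag_mx (\row_i s i ^+ 2) *m U ->
  perm_eq (singular_values A) [seq s i | i <- enum 'I_m].
Proof.
move=> UU s0 eA; rewrite perm_sort eA.
have := real_eigenvalues_diag U (\row_i s i ^+ 2) UU.
move=> /(perm_map Num.sqrt); rewrite -map_comp.
by congr perm_eq; apply: eq_map => i /=; rewrite mxE sqrtr_sqr ger0_norm.
Qed.

Lemma singular_value_ge0 {R : rcfType} {m n : nat} (A : 'M[R]_(m, n)) (i : nat) :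
  0 <= singular_value A i.
Proof.
rewrite /singular_value; have [lt_i|le_i] := ltnP i (size (singular_values A)).
  have := mem_nth 0 lt_i; rewrite mem_sort => /mapP[x _ ->]; exact: sqrtr_ge0.
by rewrite nth_default.
Qed.

(** The left half of a singular value decomposition, with the singular values
    in their sorted order; this is what links the indices of
    [singular_value] to eigenvectors. *)
Lemma gram_spectral {R : rcfType} {m n : nat} (A : 'M[R]_(m, n)) :
  exists U : 'M[R]_m, [/\ U *m U^T = 1%:M,
    A *m A^T = U^T *m diag_mx (\row_i singular_value A i ^+ 2) *m U &
    singular_values A = [seq singular_value A i | i : 'I_m <- enum 'I_m]].
Proof.
have [|U [d [UU eA]]] := symmetric_spectral (A *m A^T).
  by rewrite trmx_mul trmxK.
have eUA : (U *m A) *m (U *m A)^T = diag_mx d.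
  by rewrite trmx_mul mulmxA -(mulmxA U) eA !mulmxA UU mul1mx -mulmxA UU mulmx1.
have d0 i : 0 <= d 0 i.
  move/matrixP/(_ i i): eUA; rewrite [LHS]mxE [RHS]mxE eqxx mulr1n => <-.
  by apply: sumr_ge0 => j _; rewrite [X in _ * X]mxE -expr2 sqr_ge0.
have pA : perm_eq (singular_values A) [tuple Num.sqrt (d 0 i) | i < m].
  apply: singular_values_sqrt UU _ _ => [i|]; first exact: sqrtr_ge0.
  by rewrite eA; congr (_ *m diag_mx _ *m _); apply/rowP=> i; rewrite !mxE sqr_sqrtr.
have szA : size (singular_values A) = m by rewrite (perm_size pA) size_tuple.
(* Reorder the eigenvectors so that the singular values decrease. *)
have /tuple_permP[p ep] : perm_eq (Tuple (introT eqP szA)) [tuple Num.sqrt (d 0 i) | i < m].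
  exact: pA.
have eS (i : 'I_m) : singular_value A i = Num.sqrt (d 0 (p i)).
  rewrite /singular_value; move: ep => /= ->.
  by rewrite (nth_map i) ?size_enum_ord // nth_ord_enum tnth_mktuple.
exists (row_perm p U); split.
- by rewrite row_permE trmx_mul mulmxA -(mulmxA _ U) UU mulmx1 tr_perm_mx -perm_mxM mulgV perm_mx1.
- rewrite eA; apply/matrixP=> i j; rewrite !mxE (reindex_inj (@perm_inj _ p)) /=.
  apply: eq_bigr => l _; rewrite !mul_mx_diag !mxE eS sqr_sqrtr //.
- apply: (@eq_from_nth _ 0) => [|i]; first by rewrite size_map size_enum_ord.
  rewrite szA => lt_i.
  by rewrite (nth_map (Ordinal lt_i)) ?size_enum_ord // nth_enum_ord.
Qed.

Lemma tr_orthogonal_conj {R : comPzRingType} {n : nat} (U D : 'M[R]_n) :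
  U *m U^T = 1%:M -> \tr (U^T *m D *m U) = \tr D.
Proof. by move=> UU; rewrite mxtrace_mulC mulmxA UU mul1mx. Qed.

Lemma diag_mx_of_conj {R : comPzRingType} {n : nat} (U M D : 'M[R]_n) :
  U *m U^T = 1%:M -> M = U^T *m D *m U -> U *m M *m U^T = D.
Proof. by move=> UU ->; rewrite !mulmxA UU mul1mx -mulmxA UU mulmx1. Qed.

(** * Two expressions of the Ky Fan norm *)

(** The Ky Fan norm is the inner product of [A] with the partial isometry that
    maps the first [k] left singular vectors of [A] to the right ones. It has
    rank below [k] when some of these singular values vanish, hence only the
    inequality on its norm. *)
Lemma ky_fan_attained {R : rcfType} {m n : nat} (k : nat) (A : 'M[R]_(m, n)) :
  (k <= m)%N -> exists X : 'M[R]_(m, n),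
    [/\ X *m X^T *m X = X, \tr (X *m X^T) <= k%:R & \tr (X *m A^T) = ky_fan_norm k A].
Proof.
move=> lekm; have [U [UU eA _]] := gram_spectral A.
set D := diag_mx _ in eA.
(* Since [0^-1 = 0], vanishing singular values drop out. *)
pose e : 'rV[R]_m := \row_i ((i < k)%:R * (singular_value A i)^-1).
pose E := diag_mx e.
have eXA : U^T *m E *m U *m A *m A^T = U^T *m (E *m D) *m U.
  rewrite -mulmxA eA !mulmxA -(mulmxA (U^T *m E) U) UU mulmx1 //.
have eXX : (U^T *m E *m U *m A) *m (U^T *m E *m U *m A)^T = U^T *m (E *m D *m E) *m U.
  rewrite !trmx_mul trmxK tr_diag_mx !mulmxA eXA.
  by rewrite -(mulmxA _ U U^T) UU mulmx1 !mulmxA.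
have sum_lt (F : nat -> R) : \sum_(i < m) (i < k)%:R * F i = \sum_(i < k) F i.
  rewrite (big_ord_widen _ _ lekm) [RHS]big_mkcond.
  by apply: eq_bigr => i _; case: (i < k)%N; rewrite ?mul1r ?mul0r.
have s0 (s : R) : s == 0 \/ s * s^-1 = 1.
  by have [|n0] := eqVneq s 0; [left | right; rewrite mulfV].
exists (U^T *m E *m U *m A); split.
- rewrite eXX !mulmxA -(mulmxA _ U U^T) UU mulmx1; congr (_ *m _ *m _).
  rewrite -!(mulmxA U^T); congr (_ *m _).
  rewrite /E /D !mulmx_diag; congr diag_mx; apply/rowP=> i; rewrite !mxE.
  case: (i < k)%N; rewrite ?mul0r ?mulr0 // !mul1r.
  case: (s0 (singular_value A i)) => [/eqP->|e1]; first by rewrite invr0 !mul0r.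
  rewrite expr2; ring: e1.
- rewrite eXX tr_orthogonal_conj // /E /D !mulmx_diag mxtrace_diag.
  have -> : k%:R = \sum_(i < m) (i < k)%:R * 1 :> R.
    by rewrite (sum_lt (fun=> 1)) sumr_const card_ord.
  apply: ler_sum => i _; rewrite !mxE.
  case: (i < k)%N; rewrite ?mul0r ?mulr0 // !mul1r.
  case: (s0 (singular_value A i)) => [/eqP->|e1]; first by rewrite invr0 !mul0r ler01.
  rewrite (_ : _ * _ = 1) // expr2; ring: e1.
- rewrite eXA tr_orthogonal_conj // /E /D !mulmx_diag mxtrace_diag.
  rewrite /ky_fan_norm -sum_lt; apply: eq_bigr => i _; rewrite !mxE.
  case: (s0 (singular_value A i)) => [/eqP->|e1]; first by rewrite expr0n /= !mulr0.
  by rewrite expr2 -mulrA [X in _ * X]mulrA [X in _ * (X * _)]mulrC e1 mul1r.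
Qed.

(** Sorting puts the nonzero entries first, so the first [k] entries carry the
    whole sum as soon as at most [k] entries are nonzero. *)
Lemma sum_nth_sorted {R : realDomainType} (s : seq R) (k : nat) :
  sorted >=%R s -> (forall x, x \in s -> 0 <= x) -> (count (fun x => x != 0%R) s <= k)%N ->
  \sum_(i < k) nth 0 s i = \sum_(x <- s) x.
Proof.
elim: s k => [|x s IHs] k /=.
  by move=> _ _ _; rewrite big_nil big1 // => i _; rewrite nth_nil.
move=> pxs s0 ck.
have s0' y : y \in s -> 0 <= y by move=> ys; apply: s0; rewrite inE ys orbT.
have x0 : 0 <= x by apply: s0; rewrite mem_head.
have xmax : all (<= x) s := order_path_min ge_trans pxs.
have zero : x = 0 -> count (fun y => y != 0) s = 0%N.
  move=> x0'; apply/eqP; rewrite eqn0Ngt -has_count; apply/hasPn => y ys.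
  by rewrite negbK eq_le s0' // andbT -x0'; apply: (allP xmax).
case: k ck => [|k] ck.
  rewrite big_ord0 big_cons.
  have /eqP x0' : x == 0 by move: ck; case: eqP.
  rewrite x0' add0r big_seq big1 // => y ys; apply/eqP.
  by move: (zero x0') => /eqP; rewrite eqn0Ngt -has_count => /hasPn/(_ y ys); rewrite negbK.
rewrite big_ord_recl big_cons /=; congr (_ + _); apply: IHs => //.
  exact: path_sorted pxs.
by have [/zero ->|nx] := eqVneq x 0; rewrite // nx in ck.
Qed.

(** A positive semidefinite square root [S] of [A *m A^T] has the singular
    values of [A] as eigenvalues, hence their sum as trace. The projection [P]
    bounds the rank of [S] by [k]: an eigenvector of [S] with nonzero
    eigenvalue is fixed by [P], hence contributes 1 to the trace of [P]. *)
Lemma ky_fan_norm_sqrt {R : rcfType} {m n : nat} (k : nat) (A : 'M[R]_(m, n))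
    (S P : 'M[R]_m) :
  S *m S = A *m A^T -> S^T = S -> (forall y : 'rV[R]_m, 0 <= \tr (y *m S *m y^T)) ->
  P *m P^T = P -> S *m P = S -> \tr P <= k%:R -> ky_fan_norm k A = \tr S.
Proof.
move=> SS symS S0 PP SP trP.
have [U [d [UU eS]]] := symmetric_spectral S symS.
have UtU := mulmx1C UU.
have eD := diag_mx_of_conj _ _ _ UU eS.
have d0 i : 0 <= d 0 i.
  have := S0 (row i U); rewrite -row_mul tr_gram big_ord1.
  suff -> : d 0 i = \sum_j (U *m S) i j * U^T j i.
    by congr (_ <= _); apply: eq_bigr => j _; rewrite !mxE.
  by move/matrixP/(_ i i): eD; rewrite [LHS]mxE [RHS]mxE eqxx.
have pA : perm_eq (singular_values A) [seq d 0 i | i <- enum 'I_m].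
  apply: (singular_values_sqrt _ _ _ UU d0); rewrite -SS eS !mulmxA -(mulmxA _ U) UU mulmx1.
  rewrite -(mulmxA U^T) mulmx_diag; congr (_ *m diag_mx _ *m _).
pose G := U *m P *m U^T.
have DG : diag_mx d *m G = diag_mx d.
  by rewrite -eD /G -{2}SP !mulmxA -(mulmxA _ U^T U) UtU mulmx1.
have GG : G = (U *m P) *m (U *m P)^T by rewrite trmx_mul !mulmxA -(mulmxA U) PP.
have G0 i : 0 <= G i i.
  rewrite GG mxE; apply: sumr_ge0 => j _.
  by rewrite [X in _ * X]mxE -expr2 sqr_ge0.
have G1 i : d 0 i != 0 -> G i i = 1.
  move=> di; apply: (mulfI di).
  move/matrixP/(_ i i): DG; rewrite mul_diag_mx [LHS]mxE => ->.
  by rewrite mxE eqxx mulr1.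
have trG : \tr G = \tr P by rewrite mxtrace_mulC mulmxA UtU mul1mx.
rewrite /ky_fan_norm sum_nth_sorted.
- rewrite (perm_big _ pA) /= big_map big_enum /= eS tr_orthogonal_conj //.
  by rewrite mxtrace_diag.
- by apply: sort_sorted => x y; apply: le_total.
- by move=> x; rewrite (perm_mem pA) => /mapP[i _ ->].
- rewrite -(ler_nat R) (seq.permP pA) -sum1_count big_map natr_sum big_mkcond big_enum /=.
  apply: le_trans trP; rewrite -trG; apply: ler_sum => i _.
  by case: ifP => [/G1 ->|_].
Qed.

(** * Matrices whose nonzero singular values are equal *)

(** For the diagonal matrix of squared singular values the equation reads
    [s ^+ 4 = c ^+ 2 * s ^+ 2], that is, each [s] is 0 or [c]. *)
Lemma singular_values_flat {R : rcfType} {m n : nat} (c : R) (B : 'M[R]_(m, n)) :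
  0 < c ->
  (forall s, s \in singular_values B -> s != 0 -> s = c) <->
  (B *m B^T) *m (B *m B^T) = c ^+ 2 *: (B *m B^T).
Proof.
move=> c0; have [U [UU eB sB]] := gram_spectral B.
have cn0 : c != 0 by rewrite gt_eqF.
have eD := diag_mx_of_conj _ _ _ UU eB.
set D := diag_mx _ in eB eD.
have eP : (B *m B^T) *m (B *m B^T) = c ^+ 2 *: (B *m B^T) <-> D *m D = c ^+ 2 *: D.
  split=> [e|e].
    rewrite -{1 2}eD -(mulmxA (U *m _)) [_ *m (U *m _ *m _)]mulmxA [_ *m (U *m _)]mulmxA.
    rewrite (mulmx1C UU) mul1mx mulmxA -(mulmxA U) e -scalemxAr -scalemxAl.
    by rewrite eD.
  rewrite eB !mulmxA -(mulmxA _ U) UU mulmx1 -(mulmxA U^T) e.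
  by rewrite -scalemxAr -scalemxAl.
rewrite eP sB; split=> [flat|e].
  rewrite mulmx_diag -linearZ; congr diag_mx; apply/rowP=> i; rewrite !mxE.
  have [->|ni] := eqVneq (singular_value B i) 0; first by rewrite expr0n /= !mulr0.
  by rewrite (flat (singular_value B i)) //; apply/mapP; exists i; rewrite ?mem_enum.
move=> _ /mapP[i _ ->] ni.
move/matrixP/(_ i i): e; rewrite mulmx_diag !mxE eqxx !mulr1n.
move/mulIf => e; have /eqP : singular_value B i ^+ 2 = c ^+ 2 by apply: e; rewrite expf_neq0.
by rewrite eqrXn2 ?(ltW c0) ?singular_value_ge0 // => /eqP.
Qed.

Lemma tr_gram_flat {R : rcfType} {m n : nat} (c : R) (B : 'M[R]_(m, n)) :
  (forall s, s \in singular_values B -> s != 0 -> s = c) ->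
  \tr (B *m B^T) = c ^+ 2 * (count (fun s => s != 0) (singular_values B))%:R.
Proof.
move=> flat; have [U [UU eB sB]] := gram_spectral B.
rewrite eB tr_orthogonal_conj // mxtrace_diag -sum1_count sB big_map.
rewrite natr_sum big_distrr /= [RHS]big_mkcond /= big_enum /=.
apply: eq_bigr => i _; rewrite mxE mulr1.
have [->|ni] := eqVneq (singular_value B i) 0; first by rewrite expr0n.
by rewrite (flat (singular_value B i)) // sB; apply/mapP; exists i; rewrite ?mem_enum.
Qed.

(** * All-ones vectors and regular matrices *)

Local Notation ones n := (const_mx 1 : 'rV_n) (only parsing).

Lemma ones_mulmx {R : rcfType} {m n : nat} (B : 'M[R]_(m, n)) :
  ones m *m B = \row_j col_sum B j.
Proof. by apply/rowP=> j; rewrite !mxE; apply: eq_bigr => i _; rewrite mxE mul1r. Qed.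

Lemma mulmx_ones {R : rcfType} {m n : nat} (B : 'M[R]_(m, n)) :
  B *m (ones n)^T = \col_i row_sum B i.
Proof. by apply/colP=> i; rewrite !mxE; apply: eq_bigr => j _; rewrite !mxE mulr1. Qed.

Lemma ones_gram {R : pzSemiRingType} (n : nat) :
  ones n *m (ones n)^T = n%:R%:M :> 'M[R]_1.
Proof.
apply/matrixP=> i j; rewrite !ord1 !mxE (eq_bigr (fun=> 1)) ?sumr_const ?card_ord //.
by move=> l _; rewrite !mxE mulr1.
Qed.

Lemma all_ones_mxE {R : pzSemiRingType} (m n : nat) :
  const_mx 1 = (ones m)^T *m ones n :> 'M[R]_(m, n).
Proof. by apply/matrixP=> i j; rewrite !mxE big_ord1 !mxE mulr1. Qed.

(** By flatness [B *m B^T = c ^+ 2 *: P] with [P] a projection of rank [k], and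
    regularity puts the all-ones vector in the image of [P]. If [Q] denotes the
    projection on that vector, [P] and [Q] commute with product [Q], and the
    Gram matrix of half of [J + B] is the square of
    [(c / 2) *: (P + r *: Q)], whose trace is readily computed. *)
Lemma ky_fan_norm_flat_regular {R : rcfType} {k m n : nat} (c r : R)
    (B : 'M[R]_(m, n)) :
  (0 < m)%N -> 0 < c -> 0 < r -> r ^+ 2 = k%:R -> c ^+ 2 * r ^+ 2 = (m * n)%:R ->
  (forall j, col_sum B j = m%:R / r) -> (forall i, row_sum B i = n%:R / r) ->
  (B *m B^T) *m (B *m B^T) = c ^+ 2 *: (B *m B^T) ->
  \tr (B *m B^T) = c ^+ 2 * k%:R ->
  ky_fan_norm k (2^-1 *: (const_mx 1 + B)) = c / 2 * (k%:R + r).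
Proof.
move=> m0 c0 r0 rk cmn colB rowB flat trB.
have cn0 : c != 0 by rewrite gt_eqF.
have rn0 : r != 0 by rewrite gt_eqF.
have mn0 : m%:R != 0 :> R by rewrite pnatr_eq0 -lt0n.
pose P := c ^- 2 *: (B *m B^T).
pose Q : 'M[R]_m := m%:R^-1 *: ((ones m)^T *m ones m).
have trQ : Q^T = Q by rewrite /Q linearZ /= trmx_mul trmxK.
have trP : P^T = P by rewrite /P linearZ /= trmx_mul trmxK.
have PP : P *m P = P.
  by rewrite /P -scalemxAl -scalemxAr flat !scalerA; congr (_ *: _); field.
have QQ : Q *m Q = Q.
  rewrite /Q -scalemxAl -scalemxAr mulmxA -(mulmxA _ (ones m)) ones_gram.
  by rewrite mul_mx_scalar -scalemxAl !scalerA; congr (_ *: _); field.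
have onesB : ones m *m B = (m%:R / r) *: ones n.
  by rewrite ones_mulmx; apply/rowP=> j; rewrite !mxE colB mulr1.
have Bones : B *m (ones n)^T = (n%:R / r) *: (ones m)^T.
  by rewrite mulmx_ones; apply/colP=> j; rewrite !mxE rowB mulr1.
have nE : n%:R = c ^+ 2 * r ^+ 2 / m%:R :> R by rewrite cmn natrM mulrAC mulfV ?mul1r.
have PQ : P *m Q = Q.
  rewrite /P /Q -scalemxAl -scalemxAr scalerA (mulmxA _ (ones m)^T).
  rewrite -(mulmxA B) -trmx_mul onesB linearZ /= -scalemxAr Bones scalerA -scalemxAl scalerA.
  by congr (_ *: _); rewrite nE; field; rewrite cn0 rn0 mn0.
have QP : Q *m P = Q by rewrite -[LHS]trmxK trmx_mul trQ trP PQ trQ.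
have eB : B *m B^T = c ^+ 2 *: P by rewrite /P scalerA mulfV ?scale1r // expf_neq0.
have eQ : (ones m)^T *m ones m = m%:R *: Q by rewrite /Q scalerA mulfV ?scale1r.
have trP_k : \tr P = k%:R by rewrite /P mxtraceZ trB mulrA mulVf ?mul1r ?expf_neq0.
have trQ_1 : \tr Q = 1.
  by rewrite /Q mxtraceZ mxtrace_mulC ones_gram mxtrace_scalar mulr1n mulVf.
have onesBt : ones n *m B^T = (n%:R / r) *: ones m.
  by rewrite -[LHS]trmxK trmx_mul trmxK Bones linearZ /= trmxK.
have proj_ge0 (y : 'rV[R]_m) (T : 'M[R]_m) : T^T = T -> T *m T = T ->
    0 <= \tr (y *m T *m y^T).
  move=> trT TT; suff -> : y *m T *m y^T = (y *m T) *m (y *m T)^T by exact: tr_gram_ge0.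
  by rewrite trmx_mul trT mulmxA -(mulmxA y T T) TT.
clearbody P Q.
have eAA : (2^-1 *: (const_mx 1 + B)) *m (2^-1 *: (const_mx 1 + B))^T
    = 4^-1 *: ((n%:R * m%:R + 2 * (n%:R / r * m%:R)) *: Q + c ^+ 2 *: P).
  rewrite all_ones_mxE [(_ *: _)^T]linearZ /= [(_ + _)^T]linearD /= trmx_mul trmxK.
  rewrite -scalemxAl -scalemxAr mulmxDl !mulmxDr eB.
  rewrite mulmxA -(mulmxA _ (ones n)) ones_gram mul_mx_scalar -scalemxAl.
  rewrite -(mulmxA _ (ones n)) onesBt -scalemxAr mulmxA Bones -scalemxAl eQ.
  by apply/matrixP=> i j; rewrite !mxE; field.
pose S := (c / 2) *: (P + r *: Q).
rewrite (ky_fan_norm_sqrt k _ S P) ?trP ?trP_k //.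
- by rewrite /S mxtraceZ mxtraceD mxtraceZ trP_k trQ_1 mulr1.
- rewrite eAA /S -scalemxAl -scalemxAr mulmxDl !mulmxDr -!scalemxAl -!scalemxAr PP PQ QP QQ.
  by apply/matrixP=> i j; rewrite !mxE nE; field; rewrite rn0 mn0.
- by rewrite /S [(_ *: _)^T]linearZ /= [(_ + _)^T]linearD /= [(_ *: _)^T]linearZ /= trP trQ.
- move=> y; rewrite /S -scalemxAr mulmxDr -scalemxAr -scalemxAl mulmxDl -scalemxAl.
  rewrite mxtraceZ mxtraceD mxtraceZ mulr_ge0 ?divr_ge0 ?(ltW c0) //.
  by rewrite addr_ge0 ?proj_ge0 // mulr_ge0 ?proj_ge0 // ltW.
- by rewrite /S -scalemxAl mulmxDl -scalemxAl PP QP.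
Qed.

(** * The bound and its equality case *)

Theorem theorem3p5 (R : realType) (k m n : nat)
    (hk : (2 <= k)%N) (hkm : (k <= m)%N) (hmn : (m <= n)%N)
    (A : 'M[R]_(m, n)) (A_ge0 : forall i j, 0 <= A i j)
    (A_max : mx_norm A <= 1) :
  ky_fan_norm k A
    <= Num.sqrt (k * m * n)%:R / 2 + Num.sqrt (m * n)%:R / 2
  /\
  (ky_fan_norm k A
     = Num.sqrt (k * m * n)%:R / 2 + Num.sqrt (m * n)%:R / 2
   <->
   let B : 'M[R]_(m, n) := 2 *: A - const_mx 1 in
   [/\ pm1_matrix B,
       regular_matrix B,
       (forall i, row_sum B i = n%:R / Num.sqrt k%:R),
       count (fun s => s != 0) (singular_values B) = k &
       (forall s, s \in singular_values B -> s != 0 ->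
          s = Num.sqrt ((m * n)%:R / k%:R))]).
Proof.
have k0 : (0 < k)%N by apply: leq_trans hk.
have m0 : (0 < m)%N by apply: leq_trans hkm.
have n0 : (0 < n)%N by apply: leq_trans hmn.
have sq_nat (p : nat) : (0 < p)%N -> 0 < Num.sqrt p%:R :> R.
  by rewrite sqrtr_gt0 ltr0n.
have sqK (p : nat) : Num.sqrt p%:R ^+ 2 = p%:R :> R by rewrite sqr_sqrtr ?ler0n.
have -> : Num.sqrt ((m * n)%:R / k%:R) = Num.sqrt m%:R * Num.sqrt n%:R / Num.sqrt k%:R :> R.
  by rewrite sqrtrM ?ler0n // natrM sqrtrM ?ler0n // sqrtrV ?ler0n.
have -> : Num.sqrt (k * m * n)%:R = Num.sqrt k%:R * (Num.sqrt m%:R * Num.sqrt n%:R) :> R.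
  by rewrite -mulnA natrM sqrtrM ?ler0n // natrM sqrtrM ?ler0n.
have -> : Num.sqrt (m * n)%:R = Num.sqrt m%:R * Num.sqrt n%:R :> R.
  by rewrite natrM sqrtrM ?ler0n.
move: (sq_nat k k0) (sq_nat m m0) (sq_nat n n0) (sqK k) (sqK m) (sqK n).
move: (Num.sqrt k%:R) (Num.sqrt m%:R) (Num.sqrt n%:R) => r a b r0 a0 b0 rk am bn {sq_nat sqK}.
have rn0 : r != 0 by rewrite gt_eqF.
have an0 : a != 0 by rewrite gt_eqF.
have bn0 : b != 0 by rewrite gt_eqF.
have A1 i j : A i j <= 1.
  apply: le_trans A_max; apply: le_trans (ler_norm _) _.
  by rewrite mx_normrE; apply: (le_bigmax _ (fun ij => `|A ij.1 ij.2|) (i, j)).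
set B : 'M[R]_(m, n) := 2 *: A - const_mx 1.
have eA : A = 2^-1 *: (const_mx 1 + B).
  by rewrite /B addrC subrK scalerA mulVf ?scale1r // pnatr_eq0.
have B1 i j : `|B i j| <= 1.
  by rewrite !mxE; have := A1 i j; have := A_ge0 i j => h1 h2; rewrite ler_norml; lra.
have [trB_le trB_eq] := tr_gram_bounded B B1.
(* The common value of the nonzero singular values of [B]. *)
pose c := a * b / r.
have c0 : 0 < c by rewrite divr_gt0 ?mulr_gt0.
clearbody B.
have [X [XX trX eX]] := ky_fan_attained k A hkm.
have eXA : ky_fan_norm k A
    = 2^-1 * (\tr (ones m *m X *m (ones n)^T) + \tr (X *m B^T)).
  rewrite -eX {1}eA [(_ *: _)^T]linearZ /= [(_ + _)^T]linearD /= -scalemxAr mxtraceZ mulmxDr.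
  rewrite linearD /= all_ones_mxE trmx_mul trmxK mulmxA.
  by rewrite [\tr (_ *m ones m)]mxtrace_mulC mulmxA.
have [Xones_le Xones_eq] := partial_isometry_contraction X (ones m) XX.
rewrite ones_gram mxtrace_scalar mulr1n in Xones_le Xones_eq.
have tr_ones (p : nat) : \tr (ones p *m (ones p)^T) = p%:R :> R.
  by rewrite ones_gram mxtrace_scalar mulr1n.
have [||J_le J_eq] := tr_gram_le a b (ones m *m X) (ones n) a0 b0.
- by rewrite am.
- by rewrite tr_ones bn.
have ab0 : 0 < a * b by rewrite mulr_gt0.
have abK : (a * b) ^+ 2 = (m * n)%:R by rewrite exprMn am bn natrM.
have [||B_le B_eq] := tr_gram_le r (a * b) X B r0 ab0.
- by rewrite rk.
- by rewrite abK.
split; first by rewrite eXA; lra.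
split=> [e|/= [pmB [_ colB] rowB countB flatB]].
  rewrite eXA in e.
  have [|yX_tr _ yX] := J_eq; first by lra.
  have [|X_tr B_tr XB] := B_eq; first by lra.
  (* Both Cauchy-Schwarz bounds are attained: [B] is a multiple of the partial
     isometry [X], and [X] preserves the direction of the all-ones vectors. *)
  have eB : B = c *: X.
    by apply: (scalerI rn0); rewrite -XB scalerA [r * _]mulrC divfK.
  have eyX : ones m *m X = (a / b) *: ones n.
    by apply: (scalerI bn0); rewrite yX scalerA [b * _]mulrC divfK.
  have eP : ones m *m (X *m X^T) = ones m by apply: Xones_eq; rewrite yX_tr.
  have eXe : X *m (ones n)^T = (b / a) *: (ones m)^T.
    have -> : ones n = (b / a) *: (ones m *m X).
      by rewrite eyX scalerA mulrA divfK // divff // scale1r.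
    rewrite [(_ *: _)^T]linearZ /= -scalemxAr -{2}eP !trmx_mul trmxK.
    by rewrite mulmxA.
  have colB j : col_sum B j = m%:R / r.
    have /rowP/(_ j) : ones m *m B = (m%:R / r) *: ones n.
      rewrite eB -scalemxAr eyX scalerA -am; congr (_ *: _).
      by rewrite /c; field; rewrite bn0 rn0.
    by rewrite ones_mulmx !mxE mulr1.
  have rowB i : row_sum B i = n%:R / r.
    have /colP/(_ i) : B *m (ones n)^T = (n%:R / r) *: (ones m)^T.
      rewrite eB -scalemxAl eXe scalerA -bn; congr (_ *: _).
      by rewrite /c; field; rewrite an0 rn0.
    by rewrite mulmx_ones !mxE mulr1.
  have BB : B *m B^T = c ^+ 2 *: (X *m X^T).
    by rewrite eB [(_ *: _)^T]linearZ /= -scalemxAl -scalemxAr scalerA.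
  have flatB : forall s, s \in singular_values B -> s != 0 -> s = c.
    apply/singular_values_flat => //; rewrite BB -scalemxAl -scalemxAr.
    by rewrite mulmxA XX.
  split=> //; first by apply: trB_eq; rewrite B_tr abK.
    by split=> [i i'|j j']; rewrite ?rowB ?colB.
  have := tr_gram_flat c B flatB; rewrite BB mxtraceZ X_tr rk.
  by move/(mulfI (expf_neq0 2 (lt0r_neq0 c0)))/eqP; rewrite eqr_nat => /eqP.
(* Count the total sum of the entries by rows and by columns. *)
have {}colB j : col_sum B j = m%:R / r.
  have nn0 : n%:R != 0 :> R by rewrite pnatr_eq0 -lt0n.
  have : \sum_j' col_sum B j' = \sum_i row_sum B i by rewrite exchange_big.
  rewrite (eq_bigr (fun=> col_sum B j)) // [RHS](eq_bigr (fun=> n%:R / r)) //.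
  rewrite !sumr_const !card_ord -[LHS]mulr_natr -[RHS]mulr_natr => e.
  by apply: (mulIf nn0); rewrite e mulrAC [RHS]mulrAC [X in X / r]mulrC.
rewrite [in LHS]eA (ky_fan_norm_flat_regular c r B) //.
- by rewrite /c -rk; field.
- by rewrite /c -exprMn divfK // abK.
- by apply/singular_values_flat.
- by rewrite (tr_gram_flat c B flatB) countB.
Qed.
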